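(* Let $G$ be a $\Delta$-critical graph with multiplicity $\mu$ and let $x,y\in V(G)$ with $E_G(x,y)\neq\emptyset$. Then there exists a set $Z\subseteq K_G(y,x)$ with $$|E_G(x,Z)|\ \ge\ \Delta-\sigma'_G(x,y)-\mu_G(xy)+1\ \ge\ \Delta-d_G(y)+1$$ such that, for every $z\in Z$, $$\sigma'_G(x,y)+\sigma'_G(x,z)\ \ge\ 2\Delta-d_G(x)+2-\mu_G(xy)-\mu_G(xz)\ \ge\ 2\Delta-d_G(x)-2\mu+2.$$
   Context: All graphs are finite, undirected, loopless, and may contain parallel edges. $E_G(x,y)$ is the set of edges joining $x$ and $y$, and $\mu_G(xy)=|E_G(x,y)|$; for a vertex $x$ and vertex set $Z$, $E_G(x,Z)$ is the set of edges with one end $x$ and the other in $Z$. $N_G(x)$ is the set of vertices joined to $x$ by at least one edge, and $d_G(x)$ is the number of edges incident with $x$. The multiplicity $\mu=\mu(G)$ is the maximum of $\mu_G(uv)$ over pairs of distinct vertices. $\Delta(G)$ is the maximum degree and $\chi'(G)$ the chromatic index. $G$ is $\Delta$-critical if $\Delta(G)=\Delta$, $\chi'(G)=\Delta+1$, and $\chi'(H)<\chi'(G)$ for every proper subgraph $H$ of $G$. For an ordered pair $(x,y)$ of distinct vertices, the Kierstead set is $$K_G(x,y)=\{z\in N_G(y)\setminus\{x\}: d_G(x)+d_G(y)+d_G(z)\ge 2\Delta(G)+2\},$$ and $\sigma'_G(x,y)=|E_G(y,K_G(x,y))|$. *)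

(* Defs.v *)
From mathcomp Require Import all_boot all_order all_algebra.

Set Implicit Arguments.
Unset Strict Implicit.
Unset Printing Implicit Defensive.

(* Finite loopless multigraphs: edges form a type of their own, so parallel
   edges are distinct elements with the same two-element set of ends. *)
Record mgraph := MGraph {
  vert :> finType;
  edge : finType;
  ends : edge -> {set vert};
  card_ends : forall e, #|ends e| = 2
}.

Section Graph.
Variable G : mgraph.
Implicit Types (x y z : G) (Z : {set G}).

Definition edges x y : {set edge G} := [set e | ends e == [set x; y]].

Definition edges_to x Z : {set edge G} :=
  [set e | [exists z in Z, e \in edges x z]].

Definition mult x y : nat := #|edges x y|.

Definition nbrs x : {set G} := [set y | edges x y != set0].

Definition degree x : nat := #|[set e : edge G | x \in ends e]|.

Definition max_mult : nat := \max_(p : G * G | p.1 != p.2) mult p.1 p.2.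

Definition max_degree : nat := \max_(x : G) degree x.

Definition proper_edge_colouring k (c : {ffun edge G -> 'I_k}) : bool :=
  [forall e, forall f, (e != f) && (ends e :&: ends f != set0) ==> (c e != c f)].

Definition edge_colourable k : bool :=
  [exists c : {ffun edge G -> 'I_k}, proper_edge_colouring c].

Lemma edge_colourable_ex : exists k, edge_colourable k.
Proof.
exists #|edge G|; apply/existsP; exists [ffun e => enum_rank e].
apply/forallP => e; apply/forallP => f; apply/implyP => /andP[nef _].
by rewrite !ffunE (inj_eq enum_rank_inj).
Qed.

Definition chromatic_index : nat := ex_minn edge_colourable_ex.

Record subgraph := Subgraph {
  sub_vert : {set G};
  sub_edge : {set edge G};
  sub_ends : forall e, e \in sub_edge -> ends e \subset sub_vert
}.

Definition proper_subgraph (H : subgraph) : bool :=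
  (sub_vert H != [set: G]) || (sub_edge H != [set: edge G]).

Section ToGraph.
Variable H : subgraph.

Definition subgraph_ends (e : {e | e \in sub_edge H}) :
    {set {x | x \in sub_vert H}} :=
  [set x | val x \in ends (val e)].

Lemma card_subgraph_ends e : #|subgraph_ends e| = 2.
Proof.
rewrite -(card_ends (val e)) -(card_imset _ val_inj).
apply: eq_card => x; apply/imsetP/idP => [[u] | xe].
  by rewrite inE => ue ->.
have xH : x \in sub_vert H by apply: (subsetP (sub_ends (valP e))).
by exists (Sub x xH); rewrite ?inE.
Qed.

Definition graph_of_subgraph : mgraph := MGraph card_subgraph_ends.
End ToGraph.

Definition kierstead x y : {set G} :=
  [set z in nbrs y :\ x |
    2 * max_degree + 2 <= degree x + degree y + degree z].

Definition sigma' x y : nat := #|edges_to y (kierstead x y)|.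

End Graph.

Definition critical (D : nat) (G : mgraph) : Prop :=
  [/\ max_degree G = D,
      chromatic_index G = D.+1
    & forall H : subgraph G, proper_subgraph H ->
        chromatic_index (graph_of_subgraph H) < chromatic_index G].

(* Main.v *)
Require Import Defs.
From mathcomp Require Import all_boot all_order all_algebra perm zify.

Set Implicit Arguments.
Unset Strict Implicit.
Unset Printing Implicit Defensive.

(** Delete an edge [e] between [x] and [y] and colour the rest with [D]
    colours.  The set of colours missing at [v] has [D - degree v] elements,
    and one more if [v] is an end of [e].  Call an edge from [y] to [w <> x]
    low when [w] is outside the Kierstead set of [(x, y)], that is, when
    [degree x + degree y + degree w < 2 * D + 2]; the other edges at [y] are
    [heavy].  Let [A(y)] be the set of colours that no heavy edge at [y] has.
    A colour in [A(y)] is either missing at [y] or used on a low edge at [y],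
    and [#|A(y)| = D + 1 - sigma' x y - mult x y] ([card_free_heavy]).

    No colour of [A(y)] is missing at [x] ([free_heavy_not_missing]), so each
    of them occurs on an edge at [x].  As [#|A(y)|] is the first bound, it is
    enough that the other end [z] of such an edge [f], of colour [c] in [A(y)],
    lies in the Kierstead set of [(y, x)] and satisfies the second bound.

    After a recolouring that leaves [f] alone, [c] is missing at [y]
    ([fan_of_free_heavy]).  Then [x], [y], [z] form a Vizing fan, no colour is
    missing at two of its vertices, and this turns into the degree sum that
    puts [z] in the Kierstead set ([fan_degrees]).  Colouring [e] by [c] and
    uncolouring [f] exchanges [y] and [z], so that [A(z)] makes sense and has
    [D + 1 - sigma' x z - mult x z] elements.  Both [A(y)] and [A(z)] lie among
    the [degree x - 1] colours that are not missing at [x].  So the second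
    bound, which says [#|A(y)| + #|A(z)| <= degree x], follows once [c] is
    shown to be their only common element ([fan_free_heavy]).

    For a common colour [c'] other than [c], there are three cases.  It cannot
    be missing at both [y] and [z], by the fan property.  If it is missing at
    one of them and on a low edge at the other, counting missing colours at the
    end of the low edge yields a Kempe exchange that gives the low edge a
    colour missing at [x]; no low edge has such a colour, because its end would
    belong to a fan and satisfy the degree bound ([no_low_edge_missing]).  If
    it is on low edges at both, there are enough missing colours at the two
    ends for several such exchanges in a row ([low_pair_not_missing],
    [no_low_pair]).

    All exchanges rest on one fact: if [a] is missing at [x] and [b] at [y],
    then the [a]/[b]-chain of [x] is a path that ends at [y], so that an
    exchange started at any other vertex missing [a] or [b] leaves [x] and [y]
    alone ([hole_chain]). *)

(** * Orbits of a pair of involutions *)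

Section Dihedral.

Variables (T : finType) (s t : T -> T).
Hypotheses (sK : involutive s) (tK : involutive t).

Definition dihedral_step : rel T := [rel u v | (v == s u) || (v == t u)].

Let rot u := t (s u).

Let rot_inj : injective rot.
Proof. exact: inj_comp (inv_inj tK) (inv_inj sK). Qed.

Let rot_s u : rot (s (rot u)) = s u.
Proof. by rewrite /rot sK tK. Qed.

Lemma dihedral_step_sym : symmetric dihedral_step.
Proof.
move=> u v; rewrite /dihedral_step /= -{1}(inv_eq sK) -{1}(inv_eq tK).
by rewrite ![_ == u]eq_sym.
Qed.

(** A reflection [s] that fixes [x] sends [rot^k x] to [rot^(-k) x], so the
    rotations alone already reach the whole orbit of [x]. *)
Lemma fix_orbit_rot x v :
  s x = x -> connect dihedral_step x v -> fconnect rot x v.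
Proof.
move=> sx; have Cs u : fconnect rot x u -> fconnect rot x (s u).
  move=> /iter_findex <-; elim: (findex _ _ _) => [|k IHk]; first by rewrite /= sx.
  by rewrite iterS (same_fconnect1_r rot_inj) rot_s.
have Ct u : fconnect rot x u -> fconnect rot x (t u).
  move=> /Cs Cu; rewrite -[u]sK -/(rot _) -(same_fconnect1_r rot_inj).
  exact: Cu.
case/connectP=> p; elim/last_ind: p v => [|p u IHp] v; first by move=> _ ->.
rewrite rcons_path last_rcons => /andP[/IHp/(_ erefl) Cp].
by case/orP=> /eqP-> ->; [apply: Cs | apply: Ct].
Qed.

Let rot_s_iter k x : s x = x -> iter k rot (s (iter k rot x)) = x.
Proof.
move=> sx; elim: k => //= k IHk.
by rewrite -iterS iterSr rot_s.
Qed.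

(** Writing [v] as [rot^k x] with [k] smaller than the order [n] of the
    rotation at [x], a reflection fixing [v] forces [2k = 0] or [2k = 1]
    modulo [n]; one nonzero [k < n] satisfies this. *)
Let fix_position x v : s x = x -> v != x -> connect dihedral_step x v ->
  (s v == v) || (t v == v) ->
  exists2 k, v = iter k rot x & k.*2 = order rot x \/ k.*2 = (order rot x).+1.
Proof.
move=> sx nvx /(fix_orbit_rot sx) Cv fv.
set n := order rot x; set k := findex rot x v.
have ltkn : k < n by apply: findex_max.
have Dv : iter k rot x = v by apply: iter_findex.
have k_gt0 : 0 < k by rewrite lt0n findex_eq0 eq_sym.
exists k => //.
have inj_iter i j : i < n -> j < n -> iter i rot x = iter j rot x -> i = j.
  by move=> ltin ltjn Eij; rewrite -(findex_iter ltin) Eij findex_iter.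
have wrap i : iter (n + i) rot x = iter i rot x.
  by rewrite addnC iterD iter_order.
have svx : iter k rot (s v) = x by rewrite -Dv rot_s_iter.
have [j lej1 Ej] : exists2 j, j <= 1 & iter k.*2 rot x = iter j rot x.
  rewrite -addnn iterD Dv; case/orP: fv => /eqP fv.
    by exists 0 => //; rewrite -{1}fv.
  exists 1 => //; rewrite -{1}fv -{1}[v]sK -/(rot (s v)) -iterSr iterS.
  by rewrite svx.
have ltjn : j < n by lia.
case: (ltnP k.*2 n) => [lt2k | le2k].
  by have := inj_iter _ _ lt2k ltjn Ej; lia.
have lt2kn : k.*2 - n < n by lia.
move: Ej; rewrite -(subnKC le2k) wrap => /(inj_iter _ _ lt2kn ltjn).
lia.
Qed.

Lemma two_path_ends_s x v w : s x = x ->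
  (s v == v) || (t v == v) -> (s w == w) || (t w == w) -> v != x -> w != x ->
  connect dihedral_step x v -> connect dihedral_step x w -> v = w.
Proof.
move=> sx fv fw nvx nwx Cv Cw.
have [k -> Ek] := fix_position sx nvx Cv fv.
have [l -> El] := fix_position sx nwx Cw fw.
by congr iter; lia.
Qed.

End Dihedral.

(** A dihedral orbit is a path or a cycle, and the points fixed by one of the
    two reflections are the ends of the path. *)
Lemma two_path_ends (T : finType) (s t : T -> T) x v w :
  involutive s -> involutive t ->
  (s x == x) || (t x == x) -> (s v == v) || (t v == v) ->
  (s w == w) || (t w == w) -> v != x -> w != x ->
  connect (dihedral_step s t) x v -> connect (dihedral_step s t) x w -> v = w.
Proof.
move=> sK tK /orP[]/eqP fx fv fw nvx nwx; first exact: two_path_ends_s.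
have Est: dihedral_step s t =2 dihedral_step t s.
  by move=> u u'; rewrite /dihedral_step /= orbC.
rewrite !(eq_connect Est); apply: two_path_ends_s => //; by rewrite orbC.
Qed.

(** * Kempe chains of partial edge colourings *)

Section Colouring.

Variables (G : mgraph) (D : nat).
Implicit Types (x y z u v w : G) (e f g h : edge G) (a b c : 'I_D).
Implicit Types (phi : edge G -> option 'I_D).

Lemma edgesC x y : edges x y = edges y x.
Proof. by apply/setP=> f; rewrite !inE setUC. Qed.

Lemma edges_neq f x y : f \in edges x y -> x != y.
Proof.
rewrite inE => /eqP Df; apply/eqP=> Exy; have := card_ends f.
by rewrite Df Exy setUid cards1.
Qed.

Lemma endsE f x y v : f \in edges x y -> (v \in ends f) = (v == x) || (v == y).
Proof. by rewrite inE => /eqP->; rewrite !inE. Qed.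

Lemma ends_l f x y : f \in edges x y -> x \in ends f.
Proof. by move/endsE->; rewrite eqxx. Qed.

Lemma ends_r f x y : f \in edges x y -> y \in ends f.
Proof. by move/endsE->; rewrite eqxx orbT. Qed.

Lemma other_end f v : v \in ends f -> exists u, f \in edges v u.
Proof.
have /eqP/cards2P[p [q [_ Df]]] := card_ends f; rewrite Df !inE.
case/orP=> /eqP->; [exists q | exists p]; rewrite !inE Df //.
by rewrite setUC.
Qed.

Lemma edges_inj f v u w : f \in edges v u -> f \in edges v w -> u = w.
Proof.
move=> fu fw; have := endsE u fw; rewrite (ends_r fu) => /esym/orP[]/eqP // Euv.
by have := edges_neq fu; rewrite Euv eqxx.
Qed.

Definition proper phi := forall f g v,
  v \in ends f -> v \in ends g -> phi f != None -> phi f = phi g -> f = g.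

Definition free phi (F : {set edge G}) :=
  [set c : 'I_D | [forall f in F, phi f != Some c]].

Definition missing phi v := free phi [set f | v \in ends f].

Lemma freeP phi (F : {set edge G}) c :
  reflect (forall f, f \in F -> phi f != Some c) (c \in free phi F).
Proof. by rewrite inE; apply: forall_inP. Qed.

Lemma missingP phi v c :
  reflect (forall f, v \in ends f -> phi f != Some c) (c \in missing phi v).
Proof.
by apply: (iffP (freeP _ _ _)) => H f vf; apply: H; rewrite inE in vf *.
Qed.

Lemma present phi v c :
  c \notin missing phi v -> exists u f, f \in edges v u /\ phi f = Some c.
Proof.
rewrite inE => /forall_inPn[f]; rewrite inE negbK => vf /eqP Ef.
by have [u fu] := other_end vf; exists u, f.
Qed.

Lemma notin_missing phi v c f :
  v \in ends f -> phi f = Some c -> c \notin missing phi v.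
Proof. by move=> vf Ef; apply/missingP=> /(_ f vf); rewrite Ef eqxx. Qed.

(** The fixed points of [mate phi a] are the vertices that miss [a], so that
    the orbits of two of these involutions are the Kempe chains. *)
Definition mate phi a v : G :=
  odflt v [pick u | [exists f in edges v u, phi f == Some a]].

Section Chain.

Variable phi : edge G -> option 'I_D.
Hypothesis phi_proper : proper phi.

Lemma mateE a v u f : f \in edges v u -> phi f = Some a -> mate phi a v = u.
Proof.
move=> fvu Ef; rewrite /mate; case: pickP => /= [w | /(_ u)].
  case/exists_inP=> g gvw /eqP Eg; have Efg : f = g.
    by apply: (phi_proper (ends_l fvu) (ends_l gvw)); rewrite Ef // Eg.
  by apply: edges_inj gvw _; rewrite -Efg.
by case/exists_inP; exists f => //; apply/eqP.
Qed.

Lemma mate_missing a v : a \in missing phi v -> mate phi a v = v.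
Proof.
move/missingP=> av; rewrite /mate; case: pickP => //= u.
by case/exists_inP=> f /ends_l/av/negP.
Qed.

Lemma mateK a : involutive (mate phi a).
Proof.
move=> v; have [av | /present[u [f [fvu Ef]]]] := boolP (a \in missing phi v).
  by rewrite !mate_missing.
by rewrite (mateE fvu Ef) (@mateE a u v f) // edgesC.
Qed.

(** The vertex set of the component of [v] in the subgraph of the edges
    coloured [a] or [b]. *)
Definition chain a b v : {set G} :=
  [set u | connect (dihedral_step (mate phi a) (mate phi b)) v u].

Lemma chain_refl a b v : v \in chain a b v.
Proof. by rewrite inE connect0. Qed.

Lemma chain_sym a b v u : (u \in chain a b v) = (v \in chain a b u).
Proof.
rewrite !inE; apply: sym_connect_sym.
exact: dihedral_step_sym (@mateK a) (@mateK b).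
Qed.

Lemma chain_edge a b v f u w : f \in edges u w ->
  (phi f == Some a) || (phi f == Some b) ->
  (u \in chain a b v) = (w \in chain a b v).
Proof.
move=> fuw Ef; rewrite ![_ \in chain a b v]chain_sym !inE.
apply: same_connect (sym_connect_sym (dihedral_step_sym (@mateK a) (@mateK b))) _ _ _ _.
apply: connect1; rewrite /dihedral_step /=.
by case/orP: Ef => /eqP Ef; rewrite (mateE fuw Ef) eqxx ?orbT.
Qed.

(** A vertex missing [a] or [b] is an end of its chain, and a chain has at
    most two ends. *)
Lemma chain_third_end a b x y w :
  (a \in missing phi x) || (b \in missing phi x) ->
  (a \in missing phi y) || (b \in missing phi y) ->
  (a \in missing phi w) || (b \in missing phi w) ->
  y != x -> w != x -> w != y -> y \in chain a b x -> w \notin chain a b x.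
Proof.
have fixed v : (a \in missing phi v) || (b \in missing phi v) ->
    (mate phi a v == v) || (mate phi b v == v).
  by case/orP=> /mate_missing->; rewrite eqxx ?orbT.
move=> /fixed fx /fixed fy /fixed fw nyx nwx /negP nwy Cy; apply/negP=> Cw.
case: nwy; rewrite !inE in Cy Cw; apply/eqP.
by apply: two_path_ends fx fw fy nwx nyx Cw Cy; apply: mateK.
Qed.

Definition kempe a b v : edge G -> option 'I_D := fun f =>
  if [disjoint ends f & chain a b v] then phi f else omap (tperm a b) (phi f).

(** An edge of colour [a] or [b] has both or none of its ends in the chain, and
    [tperm a b] fixes every other colour; so one end of [f] decides. *)
Lemma kempeE a b v f u : u \in ends f ->
  kempe a b v f = if u \in chain a b v then omap (tperm a b) (phi f) else phi f.
Proof.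
move=> uf; have [w fuw] := other_end uf; rewrite /kempe.
have -> : [disjoint ends f & chain a b v]
    = (u \notin chain a b v) && (w \notin chain a b v).
  move: fuw; rewrite inE => /eqP->.
  by rewrite disjoints_subset subUset !sub1set !in_setC.
case Df: (phi f) => [c|]; last by rewrite !if_same.
have [ac | nac] := eqVneq c a.
  by rewrite -(@chain_edge a b v f u w) ?Df ?ac ?eqxx // andbb if_neg.
have [bc | nbc] := eqVneq c b.
  by rewrite -(@chain_edge a b v f u w) ?Df ?bc ?eqxx ?orbT // andbb if_neg.
by rewrite /= tpermD 1?eq_sym // !if_same.
Qed.

Lemma kempe_None a b v f : (kempe a b v f == None) = (phi f == None).
Proof. by rewrite /kempe; case: ifP => //; case: (phi f). Qed.

Lemma kempe_proper a b v : proper (kempe a b v).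
Proof.
move=> f g u uf ug; rewrite kempe_None (kempeE _ _ _ uf) (kempeE _ _ _ ug) => nf Efg.
apply: (phi_proper uf ug nf); move: Efg; case: ifP => // _.
by apply: inj_omap; apply: perm_inj.
Qed.

Lemma missing_kempe a b v u c : (c \in missing (kempe a b v) u) =
  ((if u \in chain a b v then tperm a b c else c) \in missing phi u).
Proof.
apply/missingP/missingP=> H f uf; have := H f uf; rewrite (kempeE _ _ _ uf).
  case: ifP => // _; apply: contra => /eqP->; by rewrite /= tpermK.
case: ifP => // _; apply: contra; case: (phi f) => //= d /eqP[<-].
by rewrite tpermK.
Qed.

End Chain.

End Colouring.

(** * Recolouring around one uncoloured edge *)

Lemma pigeonhole (T : finType) (A B F : {set T}) :
  A \subset ~: F -> B \subset ~: F -> #|T| < #|A| + #|B| + #|F| ->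
  exists2 b, b \in A & b \in B.
Proof.
move=> AF BF lt; suff /set0Pn[b /setIP[]] : A :&: B != set0 by exists b.
have UF : A :|: B \subset ~: F by rewrite subUset AF.
have := cardsU A B; have := subset_leq_card UF; have := cardsC F.
by rewrite -card_gt0; have := subset_leq_card (subsetIl A B); lia.
Qed.

Section Recolouring.

Variables (G : mgraph) (D : nat).
Implicit Types (x y z u v w : G) (e f g h : edge G) (a b c : 'I_D).
Implicit Types (phi : edge G -> option 'I_D).

Definition colouring_but e phi :=
  proper phi /\ forall f, (phi f == None) = (f == e).

(** The edges of [F], the uncoloured one aside, have distinct colours because
    they meet at [v]. *)
Lemma card_free e phi (F : {set edge G}) v : colouring_but e phi ->
  (forall f, f \in F -> v \in ends f) ->
  #|free phi F| + #|F| = D + (e \in F).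
Proof.
move=> [phi_proper phiN] Fv.
have E : [set Some c | c in ~: free phi F] = phi @: (F :\ e).
  apply/setP=> o; apply/imsetP/imsetP=> [[c] | [f]].
    rewrite !inE => /forall_inPn[f Ff]; rewrite negbK => /eqP Ef ->.
    by exists f; rewrite // !inE Ff -phiN Ef.
  rewrite !inE -phiN => /andP[]; case Ef: (phi f) => [c|] // _ Ff ->.
  exists c => //; rewrite !inE; apply/forall_inPn; exists f => //.
  by rewrite Ef eqxx.
have := cardsC (free phi F); rewrite card_ord.
have <-: #|phi @: (F :\ e)| = #|~: free phi F|.
  by rewrite -E card_imset //; apply: Some_inj.
rewrite card_in_imset => [|f g]; last first.
  rewrite !inE -!phiN => /andP[nf /Fv vf] /andP[_ /Fv vg].
  exact: phi_proper vf vg nf.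
by move=> Ec; rewrite (cardsD1 e F); lia.
Qed.

Lemma card_missing e phi v : colouring_but e phi ->
  #|missing phi v| + degree v = D + (v \in ends e).
Proof.
move=> phiP; rewrite (card_free (v := v) phiP) ?inE // => f.
by rewrite inE.
Qed.

Lemma kempe_colouring e phi a b v :
  colouring_but e phi -> colouring_but e (kempe phi a b v).
Proof.
move=> [phi_proper phiN]; split; first exact: kempe_proper.
by move=> f; rewrite kempe_None.
Qed.

Definition recolour phi g o : edge G -> option 'I_D :=
  fun f => if f == g then o else phi f.

Lemma recolour_same phi g o : recolour phi g o g = o.
Proof. by rewrite /recolour eqxx. Qed.

Lemma recolour_other phi g o f : f != g -> recolour phi g o f = phi f.
Proof. by rewrite /recolour => /negPf->. Qed.

Lemma recolour_proper phi g o : proper phi ->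
  (forall c v f, o = Some c -> v \in ends g -> v \in ends f -> f != g ->
     phi f != Some c) ->
  proper (recolour phi g o).
Proof.
move=> phi_proper free_o f h v vf vh; rewrite /recolour.
case: (eqVneq f g) => [Ef | nf]; case: (eqVneq h g) => [Eh | nh] nN E.
- by rewrite Ef Eh.
- case: o free_o nN E => // c /(_ c v h erefl) free_c _ /esym/eqP E.
  by move: free_c; rewrite -Ef => /(_ vf vh); rewrite Ef E => /(_ nh).
- case: o free_o E nN => [c|_ ->] // /(_ c v f erefl) free_c /eqP E _.
  by move: free_c; rewrite -Eh => /(_ vh vf); rewrite Eh E => /(_ nf).
exact: phi_proper vf vh nN E.
Qed.

Lemma missing_recolour phi g o v c : proper phi ->
  (v \in ends g -> o != Some c) ->
  (c \in missing phi v) || (v \in ends g) && (phi g == Some c) ->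
  c \in missing (recolour phi g o) v.
Proof.
move=> phi_proper no old; apply/missingP=> f vf; rewrite /recolour.
case: (eqVneq f g) => [Ef | nf]; first by apply: no; rewrite -Ef.
case/orP: old => [/missingP/(_ f vf) // | /andP[vg /eqP Eg]].
apply: contra nf => /eqP Ef; apply/eqP.
by apply: (phi_proper f g v vf vg); rewrite Ef // Eg.
Qed.

Lemma recolour_colouring e phi g y w b : colouring_but e phi -> g != e ->
  g \in edges y w -> b \in missing phi y -> b \in missing phi w ->
  colouring_but e (recolour phi g (Some b)).
Proof.
move=> [phi_proper phiN] nge gyw /missingP by_ /missingP bw; split.
  apply: recolour_proper => // c v f [<-]; rewrite (endsE _ gyw).
  by case/orP=> /eqP-> vf _; [apply: by_ | apply: bw].
move=> f; rewrite /recolour; case: (eqVneq f g) => [-> | _]; last exact: phiN.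
by rewrite (negPf nge).
Qed.

(** Moving the hole from [e] to [f], where [c] is the colour of [f]. *)
Definition shift phi e f c := recolour (recolour phi f None) e (Some c).

(** The data of a Vizing fan at [x] with just two edges. *)
Record fan x y z e f c phi : Prop := Fan {
  fan_colouring : colouring_but e phi;
  fan_hole : e \in edges x y;
  fan_edge : f \in edges x z;
  fan_colour : phi f = Some c;
  fan_missing : c \in missing phi y
}.

Lemma coloured_neq e phi f c : colouring_but e phi -> phi f = Some c -> f != e.
Proof. by case=> _ phiN Ef; rewrite -phiN Ef. Qed.

Lemma fan_neq x y z e f c phi : fan x y z e f c phi -> z != y.
Proof.
case=> _ _ fxz Ef cy; apply: contraL cy => /eqP <-.
exact: notin_missing (ends_r fxz) Ef.
Qed.

Lemma shift_other phi e f c g : g != e -> g != f -> shift phi e f c g = phi g.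
Proof. by move=> ne nf; rewrite /shift !recolour_other. Qed.

(** The shift exchanges the roles of the two edges, so that every statement on
    fans has a mirror image. *)
Lemma fan_shift x y z e f c phi :
  fan x y z e f c phi -> fan x z y f e c (shift phi e f c).
Proof.
move=> Fphi; have nzy := fan_neq Fphi; case: Fphi => phiP exy fxz Ef cy.
have nfe := coloured_neq phiP Ef; case: (phiP) => phi_proper phiN.
have N_proper : proper (recolour phi f None) by apply: recolour_proper.
have nyf : y \notin ends f.
  by rewrite (endsE _ fxz) negb_or eq_sym (edges_neq exy) eq_sym.
have S_proper : proper (shift phi e f c).
  apply: recolour_proper => // b v g [<-] ve vg nge.
  rewrite /recolour; case: (eqVneq g f) => // ngf.
  move: ve; rewrite (endsE _ exy) => /orP[] /eqP Ev; move: vg; rewrite Ev => vg.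
    apply: contra ngf => /eqP Eg; apply/eqP.
    by apply: (phi_proper g f x vg (ends_l fxz)); rewrite Eg // Ef.
  by have /missingP := cy; apply.
split=> //; last 2 first.
- by rewrite /shift recolour_same.
- apply: missing_recolour => //.
    rewrite (endsE _ exy) (negPf nzy) orbF => /eqP zx.
    by have := edges_neq fxz; rewrite zx eqxx.
  apply/orP; left; apply: missing_recolour => //.
  by rewrite (ends_r fxz) Ef eqxx orbT.
split=> // g; rewrite /shift /recolour; case: (eqVneq g e) => [-> | nge].
  by rewrite [e == f]eq_sym (negPf nfe).
by case: (eqVneq g f) => // _; rewrite phiN (negPf nge).
Qed.

(** Only [y] loses a missing colour in the shift: at [x] the colour [c] just
    moves from [f] to [e]. *)
Lemma missing_shift x y z e f c phi v b : fan x y z e f c phi ->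
  v != y -> b \in missing phi v -> b \in missing (shift phi e f c) v.
Proof.
move=> [[phi_proper phiN] exy fxz Ef cy] nvy bv.
apply: missing_recolour; first exact: recolour_proper.
  rewrite (endsE _ exy) (negPf nvy) orbF => /eqP vx.
  by move: bv; apply: contraL => /eqP[<-]; rewrite vx (notin_missing (ends_l fxz)).
by apply/orP; left; apply: missing_recolour => //; rewrite bv.
Qed.

End Recolouring.

(** * Fans and Kierstead paths when no full colouring exists *)

(** [lia] splits on every Boolean hypothesis in the context, while the counts
    only need the inequalities. *)
Ltac count_lia := intros; repeat match goal with
  | H : is_true ?b |- _ => lazymatch b with leq _ _ => fail | _ => clear H end
  end; lia.

Section Uncolourable.

Variables (G : mgraph) (D : nat).
Hypotheses (max_degreeG : max_degree G = D) (class2 : ~~ edge_colourable G D).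
Implicit Types (x y z u v w : G) (e f g h : edge G) (a b c d : 'I_D).
Implicit Types (phi psi : edge G -> option 'I_D).

Lemma degree_le v : degree v <= D.
Proof. by rewrite -max_degreeG /max_degree; apply: leq_bigmax. Qed.

Lemma no_full_colouring phi (i0 : 'I_D) :
  proper phi -> (forall f, phi f != None) -> False.
Proof.
move=> phi_proper phiN; case/existsP: class2.
exists [ffun f => odflt i0 (phi f)]; apply/forallP=> f; apply/forallP=> g.
apply/implyP=> /andP[nfg /set0Pn[v]]; rewrite inE => /andP[vf vg].
rewrite !ffunE; apply: contra nfg => /eqP E; apply/eqP.
apply: (phi_proper _ _ _ vf vg (phiN f)).
by move: (phiN f) (phiN g) E; case: (phi f); case: (phi g) => //= c d _ _ ->.
Qed.

(** A colour missing at both ends could be given to the hole. *)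
Lemma hole_missing_disjoint e phi x y c : colouring_but e phi -> e \in edges x y ->
  c \in missing phi x -> c \notin missing phi y.
Proof.
move=> [phi_proper phiN] exy /missingP cx; apply/negP=> /missingP cy.
apply: (@no_full_colouring (recolour phi e (Some c)) c) => [|f].
  apply: recolour_proper => // d v f [<-]; rewrite (endsE _ exy).
  by case/orP=> /eqP-> vf _; [apply: cx | apply: cy].
by rewrite /recolour; case: (eqVneq f e) => // nfe; rewrite phiN.
Qed.

Lemma hole_disjoint e phi x y : colouring_but e phi -> e \in edges x y ->
  [disjoint missing phi x & missing phi y].
Proof.
move=> phiP exy; apply/pred0P=> b /=; apply/negP=> /andP[].
by move=> /(hole_missing_disjoint phiP exy)/negP.
Qed.

(** The chain of [x] must end at [y]: otherwise exchanging the colours along it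
    makes [b] missing at both ends of the hole.  Hence no third chain end lies
    on it. *)
Lemma hole_chain e phi x y w a b : colouring_but e phi -> e \in edges x y ->
  a \in missing phi x -> b \in missing phi y -> w != x -> w != y ->
  (a \in missing phi w) || (b \in missing phi w) ->
  (x \notin chain phi a b w) /\ (y \notin chain phi a b w).
Proof.
move=> phiP exy ax by_ nwx nwy abw; have phi_proper := phiP.1.
have Cxy : y \in chain phi a b x.
  have := hole_missing_disjoint (c := b) (kempe_colouring a b x phiP) exy.
  rewrite !missing_kempe // chain_refl tpermR => /(_ ax).
  by case: ifP => // _; rewrite by_.
have nyx : y != x by rewrite eq_sym (edges_neq exy).
have abx : (a \in missing phi x) || (b \in missing phi x) by rewrite ax.
have aby : (a \in missing phi y) || (b \in missing phi y) by rewrite by_ orbT.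
split; rewrite chain_sym //; first exact: chain_third_end Cxy.
apply: (chain_third_end phi_proper aby abx abw); rewrite // 1?eq_sym //.
by rewrite chain_sym.
Qed.

(** What later arguments need of the exchange at [w]. *)
Record kempe_spec e phi x y w a b psi : Prop := KempeSpec {
  kempe_good : colouring_but e psi;
  kempe_x : forall h, x \in ends h -> psi h = phi h;
  kempe_y : forall h, y \in ends h -> psi h = phi h;
  kempe_missing_x : missing psi x = missing phi x;
  kempe_missing_y : missing psi y = missing phi y;
  kempe_gain : b \in missing psi w;
  kempe_at : forall h, w \in ends h -> phi h = Some b -> psi h = Some a;
  kempe_keep : forall h c, c != a -> c != b -> phi h = Some c -> psi h = Some c
}.

Lemma hole_kempe e phi x y w a b : colouring_but e phi -> e \in edges x y ->
  a \in missing phi x -> b \in missing phi y -> w != x -> w != y ->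
  a \in missing phi w -> kempe_spec e phi x y w a b (kempe phi a b w).
Proof.
move=> phiP exy ax by_ nwx nwy aw; have phi_proper := phiP.1.
have [| nCx nCy] := hole_chain phiP exy ax by_ nwx nwy; first by rewrite aw.
split.
- exact: kempe_colouring.
- by move=> h xh; rewrite (kempeE phi_proper _ _ _ xh) (negPf nCx).
- by move=> h yh; rewrite (kempeE phi_proper _ _ _ yh) (negPf nCy).
- by apply/setP=> c; rewrite missing_kempe // (negPf nCx).
- by apply/setP=> c; rewrite missing_kempe // (negPf nCy).
- by rewrite missing_kempe // chain_refl tpermR.
- by move=> h wh Eh; rewrite (kempeE phi_proper _ _ _ wh) chain_refl Eh /= tpermR.
move=> h c nca ncb Eh; rewrite /kempe Eh /= tpermD ?if_same // eq_sym //.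
Qed.

Lemma missing_ex e phi x y : colouring_but e phi -> e \in edges x y ->
  exists a, a \in missing phi x.
Proof.
move=> phiP exy; apply/set0Pn; rewrite -card_gt0.
by have := card_missing x phiP; rewrite (ends_l exy); have := degree_le x; count_lia.
Qed.

(** After the shift, [f] is the hole. *)
Lemma fan_missing_xz x y z e f c phi b : fan x y z e f c phi ->
  b \in missing phi x -> b \notin missing phi z.
Proof.
move=> Fphi bx; have [phiP' fxz exy _ _] := fan_shift Fphi.
have nxy := edges_neq exy; have nzy := fan_neq Fphi.
have := hole_missing_disjoint phiP' fxz (missing_shift Fphi nxy bx).
apply: contra; exact: (missing_shift Fphi).
Qed.

(** Otherwise an exchange with a colour missing at [x], started at [z], makes
    that colour missing at both [x] and [z]. *)
Lemma fan_missing_yz x y z e f c phi b : fan x y z e f c phi ->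
  b \in missing phi y -> b \notin missing phi z.
Proof.
move=> Fphi by_; apply/negP=> bz; have nzy := fan_neq Fphi.
have [phiP exy fxz Ef cy] := Fphi.
have [a ax] := missing_ex phiP exy.
have nzx : z != x by rewrite eq_sym (edges_neq fxz).
have [| nCx nCy] := hole_chain phiP exy ax by_ nzx nzy; first by rewrite bz orbT.
have phi_proper := phiP.1.
have Fpsi : fan x y z e f c (kempe phi a b z).
  split=> //; first exact: kempe_colouring.
    by rewrite (kempeE phi_proper _ _ _ (ends_l fxz)) (negPf nCx).
  by rewrite missing_kempe // (negPf nCy).
have := fan_missing_xz (b := a) Fpsi.
by rewrite !missing_kempe // (negPf nCx) chain_refl tpermL bz => /(_ ax).
Qed.

(** The three sets of missing colours are disjoint, hence have at most [D]
    elements together. *)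
Lemma fan_degrees x y z e f c phi : fan x y z e f c phi ->
  2 * D + 2 <= degree x + degree y + degree z.
Proof.
move=> Fphi; have [phiP exy fxz _ _] := Fphi; have nzy := fan_neq Fphi.
have Dxy := hole_disjoint phiP exy.
have Dxyz : [disjoint missing phi x :|: missing phi y & missing phi z].
  apply/pred0P=> b /=; apply/negP=> /andP[/setUP[bx | by_]]; apply/negP.
    exact: (fan_missing_xz Fphi).
  exact: (fan_missing_yz Fphi).
have := max_card (missing phi x :|: missing phi y :|: missing phi z).
rewrite card_ord !cardsU (disjoint_setI0 Dxyz) (disjoint_setI0 Dxy) !cards0.
have := card_missing x phiP; have := card_missing y phiP.
have := card_missing z phiP; rewrite (ends_l exy) (ends_r exy).
by have := degree_le x; have := degree_le y; have := degree_le z; count_lia.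
Qed.

(** [e] and [g] form a fan at [y]. *)
Lemma colour_at_other_end e phi x y g w c : colouring_but e phi ->
  e \in edges x y -> g \in edges y w -> phi g = Some c -> c \in missing phi x ->
  2 * D + 2 <= degree x + degree y + degree w.
Proof.
move=> phiP exy gyw Eg cx; rewrite [degree x + _]addnC.
by apply: (@fan_degrees y x w e g c phi); split; rewrite // edgesC.
Qed.

(** After the shift, [f] and [g] form a fan at [z]. *)
Lemma colour_beyond_fan x y z e f c phi g w d : fan x y z e f c phi ->
  g \in edges z w -> phi g = Some d -> d \in missing phi x ->
  2 * D + 2 <= degree x + degree z + degree w.
Proof.
move=> Fphi gzw Eg dx; have [phiP' fxz exy _ _] := fan_shift Fphi.
have [phiP _ fxz' Ef _] := Fphi.
apply: (@colour_at_other_end f (shift phi e f c) x z g w d) => //.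
  rewrite shift_other ?(coloured_neq phiP Eg) //.
  apply: contraL dx => /eqP Egf.
  by apply: notin_missing (ends_l fxz) _; rewrite -Egf.
exact: missing_shift Fphi (edges_neq exy) dx.
Qed.

(** * Colours shared beyond both ends of a fan *)

Section SharedColour.

Variables (x y z : G) (e f : edge G) (c c' : 'I_D).
Hypothesis nc'c : c' != c.

(** By the degree bound, the sets of colours missing at [x], [z] and [w] have at
    least [D] elements together; they all avoid [c'], and those of [x] and [z]
    are disjoint. *)
Lemma low_end_meets phi w g : fan x y z e f c phi -> c' \notin missing phi x ->
  g \in edges z w -> phi g = Some c' -> w != x -> w != y ->
  degree x + degree z + degree w < 2 * D + 2 ->
  exists2 d, d \in missing phi w &
    (d \in missing phi x) || (d \in missing phi z).
Proof.
move=> Fphi nc'x gzw Eg nwx nwy low; have [phiP exy fxz _ _] := Fphi.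
have nc'z := notin_missing (ends_l gzw) Eg.
have nc'w := notin_missing (ends_r gzw) Eg.
have Dxz : [disjoint missing phi x & missing phi z].
  by apply/pred0P=> b /=; apply/negP=> /andP[/(fan_missing_xz Fphi)/negP].
have [d] : exists2 d, d \in missing phi x :|: missing phi z & d \in missing phi w.
  apply: (@pigeonhole _ _ _ [set c']).
  - by rewrite subsetC sub1set in_setC in_setU negb_or nc'x.
  - by rewrite subsetC sub1set in_setC.
  rewrite card_ord cards1 cardsU (disjoint_setI0 Dxz) cards0.
  have := card_missing x phiP; have := card_missing z phiP.
  have := card_missing w phiP; rewrite (ends_l exy).
  by have := degree_le x; have := degree_le z; have := degree_le w; count_lia.
by move=> /setUP dxz dw; exists d => //; apply/orP.
Qed.

(** The colour [d] supplied by the count either makes [c'] missing at [z] as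
    well as at [y], or, after an exchange at [w], colours [g] although it is
    missing at [x]. *)
Lemma no_low_edge_missing phi w g : fan x y z e f c phi ->
  c' \in missing phi y -> g \in edges z w -> phi g = Some c' -> w != x ->
  degree x + degree z + degree w < 2 * D + 2 -> False.
Proof.
move=> Fphi c'y gzw Eg nwx low; have nzy := fan_neq Fphi.
have [phiP exy fxz Ef cy] := Fphi.
have nwy : w != y.
  by apply: contraL c'y => /eqP <-; apply: notin_missing (ends_r gzw) Eg.
have nc'x : c' \notin missing phi x.
  by apply: contraL c'y; apply: hole_missing_disjoint exy.
have [d dw /orP[dx | dz]] := low_end_meets Fphi nc'x gzw Eg nwx nwy low.
  have K := hole_kempe phiP exy dx c'y nwx nwy dw.
  have Fpsi : fan x y z e f c (kempe phi d c' w).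
    split=> //; first exact: kempe_good K.
      by rewrite (kempe_x K) // (ends_l fxz).
    by rewrite (kempe_missing_y K).
  have := colour_beyond_fan (d := d) Fpsi gzw (kempe_at K (ends_r gzw) Eg).
  by rewrite (kempe_missing_x K) => /(_ dx); count_lia.
have nge := coloured_neq phiP Eg.
have nyg : y \notin ends g by rewrite (endsE _ gzw) negb_or ![y == _]eq_sym nzy.
have phi_proper := phiP.1.
have Fpsi : fan x y z e f c (recolour phi g (Some d)).
  split=> //; first exact: recolour_colouring gzw dz dw.
    rewrite recolour_other //; apply: contra nc'c => /eqP Efg.
    by rewrite -Efg Ef in Eg; case: Eg => ->.
  by apply: missing_recolour; rewrite ?(negPf nyg) ?cy.
suff /negP[]: c' \notin missing (recolour phi g (Some d)) z.
  apply: missing_recolour => // [_|]; last by rewrite (ends_l gzw) Eg eqxx orbT.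
  apply: contraL dz => /eqP[->]; exact: notin_missing (ends_l gzw) Eg.
apply: fan_missing_yz Fpsi _.
by apply: missing_recolour; rewrite ?(negPf nyg) ?c'y.
Qed.

End SharedColour.

(** If [w1] misses a colour [b] that [y] misses too, recolouring [g1] by [b]
    makes [c'] missing at [y], and then [no_low_edge_missing] applies to [g2]. *)
Lemma low_edges_no_common_missing x y z e f c c' phi g1 w1 g2 w2 b :
  c' != c -> fan x y z e f c phi ->
  g1 \in edges y w1 -> phi g1 = Some c' -> w1 != z ->
  g2 \in edges z w2 -> phi g2 = Some c' -> w2 != x ->
  degree x + degree z + degree w2 < 2 * D + 2 ->
  b != c -> b \in missing phi y -> b \in missing phi w1 -> False.
Proof.
move=> nc'c Fphi g1yw Eg1 nw1z g2zw Eg2 nw2x low2 nbc by_ bw.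
have nzy := fan_neq Fphi; have [phiP exy fxz Ef cy] := Fphi.
have ng1e := coloured_neq phiP Eg1; have phi_proper := phiP.1.
have nbc' : b != c'.
  by apply: contraL by_ => /eqP->; apply: notin_missing (ends_l g1yw) Eg1.
have nzg1 : z \notin ends g1 by rewrite (endsE _ g1yw) negb_or nzy eq_sym.
have ng21 : g2 != g1 by apply: contraNneq nzg1 => <-; apply: ends_l g2zw.
apply: (@no_low_edge_missing x y z e f c c' nc'c (recolour phi g1 (Some b)) w2 g2).
- split=> //; first exact: recolour_colouring g1yw by_ bw.
    rewrite recolour_other //; apply: contraNneq nzg1 => <-; exact: ends_r fxz.
  by apply: missing_recolour; rewrite ?cy.
- by apply: missing_recolour; rewrite ?(ends_l g1yw) ?Eg1 ?eqxx ?orbT.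
- by [].
- by rewrite recolour_other.
- by [].
by [].
Qed.

(** Recolouring [g1] by [c'] makes [c] missing at [y], which completes a fan. *)
Lemma colour_beyond_recoloured_fan x y z e f c c' phi g1 w1 g2 w2 d :
  colouring_but e phi -> e \in edges x y -> f \in edges x z -> phi f = Some c ->
  g1 \in edges y w1 -> phi g1 = Some c -> w1 != x ->
  g2 \in edges z w2 -> phi g2 = Some d -> d \in missing phi x ->
  c' \in missing phi y -> c' \in missing phi w1 ->
  2 * D + 2 <= degree x + degree z + degree w2.
Proof.
move=> phiP exy fxz Ef g1yw Eg1 nw1x g2zw Eg2 dx c'y c'w.
have phi_proper := phiP.1.
have nxg1 : x \notin ends g1.
  by rewrite (endsE _ g1yw) negb_or (edges_neq exy) eq_sym.
have ncd : c != d.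
  by apply: contraL dx => /eqP<-; apply: notin_missing (ends_l fxz) Ef.
have ncc' : c != c'.
  by apply: contraL c'y => /eqP<-; apply: notin_missing (ends_l g1yw) Eg1.
apply: (@colour_beyond_fan x y z e f c (recolour phi g1 (Some c')) g2 w2 d) => //.
- split=> //; first exact: recolour_colouring (coloured_neq phiP Eg1) g1yw _ _.
    rewrite recolour_other //; apply: contraNneq nxg1 => <-; exact: ends_l fxz.
  apply: missing_recolour; rewrite ?(ends_l g1yw) ?Eg1 ?eqxx ?orbT // => _.
  by rewrite eq_sym.
- rewrite recolour_other //; apply: contraNneq ncd => Eg; apply/eqP.
  by move: Eg2; rewrite Eg Eg1 => -[].
by apply: missing_recolour; rewrite ?(negPf nxg1) ?dx.
Qed.

(** A colour [c'] used at both ends of a fan on edges that lead outside the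
    Kierstead sets. *)
Record low_pair x y z e f c c' phi g1 w1 g2 w2 : Prop := LowPair {
  low_fan : fan x y z e f c phi;
  low_neq : c' != c;
  low_g1 : g1 \in edges y w1;
  low_c1 : phi g1 = Some c';
  low_w1 : w1 != x;
  low_d1 : degree x + degree y + degree w1 < 2 * D + 2;
  low_g2 : g2 \in edges z w2;
  low_c2 : phi g2 = Some c';
  low_w2 : w2 != x;
  low_d2 : degree x + degree z + degree w2 < 2 * D + 2
}.

Lemma low_pair_w1z x y z e f c c' phi g1 w1 g2 w2 :
  low_pair x y z e f c c' phi g1 w1 g2 w2 -> w1 != z.
Proof.
move=> L; apply: contraTneq (low_d1 L) => ->.
by rewrite -leqNgt; apply: fan_degrees (low_fan L).
Qed.

Lemma low_pair_shift x y z e f c c' phi g1 w1 g2 w2 :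
  low_pair x y z e f c c' phi g1 w1 g2 w2 ->
  low_pair x z y f e c c' (shift phi e f c) g2 w2 g1 w1.
Proof.
case=> Fphi nc'c g1P Eg1 nw1 low1 g2P Eg2 nw2 low2.
have [phiP _ _ Ef _] := Fphi.
have keep g : phi g = Some c' -> shift phi e f c g = Some c'.
  move=> Eg; rewrite shift_other ?(coloured_neq phiP Eg) //.
  by apply: contraNneq nc'c => Egf; apply/eqP; move: Ef; rewrite -Egf Eg => -[].
by split=> //; [apply: fan_shift | apply: keep | apply: keep].
Qed.

(** Otherwise [g1] would complete a fan at [y]. *)
Lemma low_pair_missing_x x y z e f c c' phi g1 w1 g2 w2 :
  low_pair x y z e f c c' phi g1 w1 g2 w2 -> c' \notin missing phi x.
Proof.
move=> L; have [phiP exy _ _ _] := low_fan L; apply/negP=> c'x.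
have := colour_at_other_end phiP exy (low_g1 L) (low_c1 L) c'x.
by have := low_d1 L; count_lia.
Qed.

Lemma low_pair_end_y x y z e f c c' phi g1 w1 g2 w2 b :
  low_pair x y z e f c c' phi g1 w1 g2 w2 ->
  b != c -> b \in missing phi y -> b \notin missing phi w1.
Proof.
move=> L nbc by_; apply/negP=> bw; have nw1z := low_pair_w1z L.
case: L => Fphi nc'c g1P Eg1 _ _ g2P Eg2 nw2 low2.
exact: (low_edges_no_common_missing nc'c Fphi g1P Eg1 nw1z g2P Eg2 nw2 low2 nbc by_ bw).
Qed.

Lemma low_pair_end_z x y z e f c c' phi g1 w1 g2 w2 d :
  low_pair x y z e f c c' phi g1 w1 g2 w2 ->
  d \in missing phi z -> d \notin missing phi w2.
Proof.
move=> L dz; have Fphi := low_fan L; have [_ _ fxz Ef _] := Fphi.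
have nzy := fan_neq Fphi.
have nw2y : w2 != y by apply: low_pair_w1z (low_pair_shift L).
have ndc : d != c.
  by apply: contraL dz => /eqP->; apply: notin_missing (ends_r fxz) Ef.
have := low_pair_end_y (low_pair_shift L) ndc (missing_shift Fphi nzy dz).
by apply: contra; apply: (missing_shift Fphi).
Qed.

(** The count at [w2] gives a colour [d] missing at [x] and [w2].  Colour [g1]
    by [c], so that [c'] is missing at [y]; exchange [d] and [c'] at [w2], so
    that [g2] gets the colour [d]; and, with the help of [a], give [g1] the
    colour [c'], so that [c] is missing at [y] again and [g2] lies beyond a
    fan. *)
Lemma low_pair_not_missing x y z e f c c' phi g1 w1 g2 w2 a :
  low_pair x y z e f c c' phi g1 w1 g2 w2 ->
  c \in missing phi w1 -> a \in missing phi x -> a \in missing phi w1 -> False.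
Proof.
move=> L cw1 ax aw1; have nc'x := low_pair_missing_x L.
have nw2y : w2 != y by apply: low_pair_w1z (low_pair_shift L).
have nw1z := low_pair_w1z L.
have end_z := low_pair_end_z L.
case: L => Fphi nc'c g1yw Eg1 nw1 low1 g2zw Eg2 nw2 low2.
have [d dw2 /orP[dx | /end_z]] :=
  low_end_meets Fphi nc'x g2zw Eg2 nw2 nw2y low2; last by rewrite dw2.
have nzy := fan_neq Fphi; have [phiP exy fxz Ef cy] := Fphi.
have phi_proper := phiP.1; have ng1e := coloured_neq phiP Eg1.
have ncx : c \notin missing phi x by apply: notin_missing (ends_l fxz) Ef.
have neq_x b1 b2 : b1 \notin missing phi x -> b2 \in missing phi x -> b1 != b2.
  by move=> nb1 b2x; apply: contraNneq nb1 => ->.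
have [nca ncd] := (neq_x _ _ ncx ax, neq_x _ _ ncx dx).
have [nc'a nc'd] := (neq_x _ _ nc'x ax, neq_x _ _ nc'x dx).
have nxg1 : x \notin ends g1.
  by rewrite (endsE _ g1yw) negb_or (edges_neq exy) eq_sym.
have nzg1 : z \notin ends g1 by rewrite (endsE _ g1yw) negb_or nzy eq_sym.
have nfg1 : f != g1 by apply: contraNneq nxg1 => <-; apply: ends_l fxz.
have ng21 : g2 != g1 by apply: contraNneq nzg1 => <-; apply: ends_l g2zw.
have nSome b : c != b -> Some c != Some b by apply: contra => /eqP[->].
pose phi1 := recolour phi g1 (Some c).
have phi1P : colouring_but e phi1 by apply: recolour_colouring g1yw cy cw1.
have free1 v b : c != b -> b \in missing phi v -> b \in missing phi1 v.
  by move=> ncb bv; apply: missing_recolour; rewrite ?bv // => _; apply: nSome.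
have c'1 v : v \in ends g1 -> c' \in missing phi1 v.
  move=> vg1; apply: missing_recolour; rewrite ?vg1 ?Eg1 ?eqxx ?orbT // => _.
  by apply: nSome; rewrite eq_sym.
have K := hole_kempe phi1P exy (free1 _ _ ncd dx) (c'1 _ (ends_l g1yw)) nw2 nw2y
  (free1 _ _ ncd dw2).
set phi2 := kempe _ _ _ _ in K; have phi2P := kempe_good K.
have Eg22 : phi2 g2 = Some d.
  by apply: (kempe_at K) (ends_r g2zw) _; rewrite /phi1 recolour_other.
have Eg12 : phi2 g1 = Some c.
  by rewrite (kempe_y K) ?(ends_l g1yw) // /phi1 recolour_same.
have Ef2 : phi2 f = Some c.
  by rewrite (kempe_x K) ?(ends_l fxz) // /phi1 recolour_other.
have dx2 : d \in missing phi2 x by rewrite (kempe_missing_x K) free1.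
have ax2 : a \in missing phi2 x by rewrite (kempe_missing_x K) free1.
have c'y2 : c' \in missing phi2 y by rewrite (kempe_missing_y K) c'1 ?(ends_l g1yw).
(* If [w1] lies on the chain of [w2], it has exchanged [c'] for [d], and then it
   still misses [a] unless [a = d]. *)
have : (c' \in missing phi2 w1) || (d != a) && (a \in missing phi2 w1).
  have aw11 := free1 _ _ nca aw1; have c'w11 := c'1 _ (ends_r g1yw).
  rewrite !missing_kempe; try exact: phi1P.1.
  case: ifP => _; last by rewrite c'w11.
  rewrite tpermR; case: (eqVneq d a) => [-> | nda]; first by rewrite aw11.
  by rewrite tpermD ?aw11 ?orbT.
case/orP=> [c'w12 | /andP[nda aw12]].
  have := colour_beyond_recoloured_fan phi2P exy fxz Ef2 g1yw Eg12 nw1 g2zw Eg22 dx2 c'y2 c'w12.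
  count_lia.
have nw1y : w1 != y by rewrite eq_sym (edges_neq g1yw).
have K' := hole_kempe phi2P exy ax2 c'y2 nw1 nw1y aw12.
set phi3 := kempe _ _ _ _ in K'.
have Ef3 : phi3 f = Some c by rewrite (kempe_x K') ?(ends_l fxz).
have Eg13 : phi3 g1 = Some c by rewrite (kempe_y K') ?(ends_l g1yw).
have Eg23 : phi3 g2 = Some d by apply: (kempe_keep K') Eg22; rewrite // eq_sym.
have dx3 : d \in missing phi3 x by rewrite (kempe_missing_x K').
have c'y3 : c' \in missing phi3 y by rewrite (kempe_missing_y K').
have := colour_beyond_recoloured_fan (kempe_good K') exy fxz Ef3 g1yw Eg13 nw1 g2zw Eg23 dx3
  c'y3 (kempe_gain K').
count_lia.
Qed.

(** The colours missing at [w1] meet those missing at [x] or [y] in at least two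
    elements, all of them [c] or missing at [x]; an exchange with [c] at [w1], if
    needed, gives the situation of [low_pair_not_missing]. *)
Lemma no_low_pair x y z e f c c' phi g1 w1 g2 w2 :
  ~ low_pair x y z e f c c' phi g1 w1 g2 w2.
Proof.
move=> L; have end_y := low_pair_end_y L.
have nc'x := low_pair_missing_x L; have [Fphi nc'c g1yw Eg1 nw1 low1 _ _ _ _] := L.
have [phiP exy fxz Ef cy] := Fphi.
have nc'y := notin_missing (ends_l g1yw) Eg1.
have nc'w := notin_missing (ends_r g1yw) Eg1.
have ncx := notin_missing (ends_l fxz) Ef.
have nw1y : w1 != y by rewrite eq_sym (edges_neq g1yw).
have Dxy := hole_disjoint phiP exy.
have := card_missing x phiP; have := card_missing y phiP.
have := card_missing w1 phiP; rewrite (ends_l exy) (ends_r exy) => Sw Sy Sx.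
have [[dx dy] dw] := (degree_le x, degree_le y, degree_le w1).
have Uxy : #|missing phi x :|: missing phi y| = #|missing phi x| + #|missing phi y|.
  by rewrite cardsU (disjoint_setI0 Dxy) cards0 subn0.
have Uc : #|(missing phi x :|: missing phi y) :\ c| + 1
    = #|missing phi x| + #|missing phi y|.
  by rewrite -Uxy [in RHS](cardsD1 c) in_setU cy orbT addnC.
have [a] : exists2 a, a \in (missing phi x :|: missing phi y) :\ c & a \in missing phi w1.
  apply: (@pigeonhole _ _ _ [set c']).
  - by rewrite subsetC sub1set in_setC in_setD1 in_setU (negPf nc'x) (negPf nc'y) andbF.
  - by rewrite subsetC sub1set in_setC.
  by rewrite card_ord cards1; count_lia.
rewrite in_setD1 in_setU => /andP[nac /orP[ax | ay]] aw1; last first.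
  by have := end_y _ nac ay; rewrite aw1.
case: (boolP (c \in missing phi w1)) => [cw1 | ncw1].
  exact: (low_pair_not_missing L cw1 ax aw1).
have [b] : exists2 b,
    b \in (missing phi x :|: missing phi y) :\ c :\ a & b \in missing phi w1.
  apply: (@pigeonhole _ _ _ [set c'; c]).
  - rewrite subsetC subUset !sub1set !in_setC !in_setD1 in_setU.
    by rewrite (negPf nc'x) (negPf nc'y) eqxx !andbF.
  - by rewrite subsetC subUset !sub1set !in_setC nc'w.
  rewrite card_ord cards2 nc'c.
  have := cardsD1 a ((missing phi x :|: missing phi y) :\ c).
  by rewrite in_setD1 in_setU nac ax; count_lia.
rewrite !in_setD1 in_setU => /andP[nba /andP[nbc /orP[bx | by_]]] bw1; last first.
  by have := end_y _ nbc by_; rewrite bw1.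
have K := hole_kempe phiP exy bx cy nw1 nw1y bw1.
have nc'b : c' != b by apply: contraNneq nc'x => ->.
have keep h : phi h = Some c' -> kempe phi b c w1 h = Some c'.
  exact: kempe_keep K _ _ nc'b nc'c.
have L' : low_pair x y z e f c c' (kempe phi b c w1) g1 w1 g2 w2.
  case: L => _ _ _ _ _ _ g2P Eg2 nw2 low2; split=> //; try exact: keep.
  split=> //; first exact: kempe_good K.
    by rewrite (kempe_x K) ?(ends_l fxz).
  by rewrite (kempe_missing_y K).
apply: (low_pair_not_missing L' (kempe_gain K) (a := a)).
  by rewrite (kempe_missing_x K).
rewrite missing_kempe; last exact: phiP.1.
by rewrite tpermD ?if_same // eq_sym.
Qed.

(** * Counting the colours on edges to low neighbours *)

(** The edges from [y] to [x] and to the Kierstead set; the count of the colours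
    they avoid is what the quantities [sigma'] and [mult] measure. *)
Definition heavy x y := edges y x :|: edges_to y (kierstead x y).

Lemma heavy_end x y h : h \in heavy x y -> y \in ends h.
Proof.
rewrite inE => /orP[/ends_l // |]; rewrite inE => /exists_inP[w _].
exact: ends_l.
Qed.

Lemma card_heavy x y : #|heavy x y| = mult x y + sigma' x y.
Proof.
rewrite cardsU edgesC (_ : _ :&: _ = set0) ?cards0 ?subn0 //.
apply/setP=> h; rewrite in_setI in_set0; apply/negP=> /andP[hxy].
rewrite inE => /exists_inP[w]; rewrite inE in_setD1 => /andP[/andP[nwx _] _] hyw.
by case/negP: nwx; rewrite edgesC in hxy; rewrite (edges_inj hyw hxy).
Qed.

Lemma card_free_heavy e phi x y : colouring_but e phi -> e \in edges x y ->
  #|free phi (heavy x y)| + mult x y + sigma' x y = D.+1.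
Proof.
move=> phiP exy; rewrite -addnA -card_heavy (card_free phiP (@heavy_end x y)).
by rewrite inE edgesC exy addn1.
Qed.

Lemma free_heavy_low e phi x y c : colouring_but e phi -> e \in edges x y ->
  c \in free phi (heavy x y) -> c \notin missing phi y ->
  exists w g, [/\ g \in edges y w, phi g = Some c, w != x &
    degree x + degree y + degree w < 2 * D + 2].
Proof.
move=> phiP exy /freeP cH /present[w [g [gyw Eg]]]; exists w, g.
have : g \notin heavy x y by apply/negP=> /cH; rewrite Eg eqxx.
rewrite in_setU negb_or => /andP[ngyx ngK].
have nwx : w != x by apply: contraNneq ngyx => <-.
split=> //; rewrite ltnNge; apply: contra ngK => high.
rewrite inE; apply/exists_inP; exists w => //.
rewrite inE in_setD1 nwx max_degreeG high andbT inE.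
by apply/set0Pn; exists g.
Qed.

(** If [c] is missing at [x], then the edge of colour [c] at [y] leads into the
    Kierstead set, by the degree bound for fans. *)
Lemma free_heavy_not_missing e phi x y c : colouring_but e phi ->
  e \in edges x y -> c \in free phi (heavy x y) -> c \notin missing phi x.
Proof.
move=> phiP exy cH; apply/negP=> cx.
have ncy := hole_missing_disjoint phiP exy cx.
have [w [g [gyw Eg _ low]]] := free_heavy_low phiP exy cH ncy.
by have := colour_at_other_end phiP exy gyw Eg cx; count_lia.
Qed.

(** A low edge at [y] of colour [c] can be recoloured by a colour missing at [y]
    once an exchange has made that colour missing at its other end. *)
Lemma fan_of_free_heavy e phi x y z f c : colouring_but e phi ->
  e \in edges x y -> f \in edges x z -> phi f = Some c ->
  c \in free phi (heavy x y) -> exists psi, fan x y z e f c psi.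
Proof.
move=> phiP exy fxz Ef cH.
have [cy | ncy] := boolP (c \in missing phi y); first by exists phi.
have [w [g [gyw Eg nwx low]]] := free_heavy_low phiP exy cH ncy.
have nwy : w != y by rewrite eq_sym (edges_neq gyw).
have ncx := notin_missing (ends_l fxz) Ef.
have nxg : x \notin ends g by rewrite (endsE _ gyw) negb_or (edges_neq exy) eq_sym.
have nfg : f != g by apply: contraNneq nxg => <-; apply: ends_l fxz.
have build psi b : colouring_but e psi -> psi f = Some c -> psi g = Some c ->
    b \in missing psi y -> b \in missing psi w -> exists psi, fan x y z e f c psi.
  move=> psiP psif psig by_ bw; exists (recolour psi g (Some b)).
  split=> //; first exact: recolour_colouring (coloured_neq psiP psig) gyw by_ bw.
    by rewrite recolour_other.
  apply: missing_recolour; first exact: psiP.1.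
    move=> _; apply: contraTneq by_ => -[->].
    exact: notin_missing (ends_l gyw) psig.
  by rewrite (ends_l gyw) psig eqxx orbT.
have [b by_] : exists b, b \in missing phi y.
  by apply: missing_ex phiP _; rewrite edgesC; apply: exy.
have [a] : exists2 a, a \in missing phi x :|: missing phi y & a \in missing phi w.
  apply: (@pigeonhole _ _ _ set0); rewrite ?setC0 ?subsetT // card_ord cards0.
  have Dxy := hole_disjoint phiP exy.
  rewrite cardsU (disjoint_setI0 Dxy) cards0.
  have := card_missing x phiP; have := card_missing y phiP.
  have := card_missing w phiP; rewrite (ends_l exy) (ends_r exy).
  by have := degree_le x; have := degree_le y; have := degree_le w; count_lia.
case/setUP=> [ax aw | ay aw]; last exact: build phiP Ef Eg ay aw.
have K := hole_kempe phiP exy ax by_ nwx nwy aw.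
apply: (build _ b (kempe_good K)) (kempe_gain K).
- by rewrite (kempe_x K) ?(ends_l fxz).
- by rewrite (kempe_y K) ?(ends_l gyw).
by rewrite (kempe_missing_y K).
Qed.

(** Both sets avoid the colours missing at [x], and [c] is the one colour they
    share. *)
Lemma fan_free_heavy x y z e f c phi : fan x y z e f c phi ->
  #|free phi (heavy x y)| + #|free (shift phi e f c) (heavy x z)| <= degree x.
Proof.
move=> Fphi; have Fpsi := fan_shift Fphi.
have [phiP exy fxz Ef cy] := Fphi; have [psiP _ _ _ cz] := Fpsi.
set psi := shift _ _ _ _ in psiP cz Fpsi *; set A := free phi _; set B := free psi _.
have AC : A \subset ~: missing phi x.
  by apply/subsetP=> b bA; rewrite in_setC (free_heavy_not_missing phiP exy).
have BC : B \subset ~: missing phi x.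
  apply/subsetP=> b bB; rewrite in_setC.
  have := free_heavy_not_missing psiP fxz bB; apply: contra.
  exact: (missing_shift Fphi (edges_neq exy)).
have keep g b : b != c -> psi g = Some b -> phi g = Some b.
  rewrite /psi /shift /recolour => nbc; case: (g == e) => [[Ebc]|].
    by rewrite Ebc eqxx in nbc.
  by case: (g == f).
have keep' g b : b != c -> phi g = Some b -> psi g = Some b.
  move=> nbc Eg; rewrite /psi shift_other ?(coloured_neq phiP Eg) //.
  by apply: contraNneq nbc => Egf; move: Ef; rewrite -Egf Eg => -[->].
have AB : A :&: B \subset [set c].
  apply/subsetP=> b /setIP[bA bB]; rewrite in_set1; apply/negPn/negP=> nbc.
  have [b_y | nby] := boolP (b \in missing phi y);
    have [bz | nbz] := boolP (b \in missing psi z).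
  - have /negP[] := fan_missing_yz Fphi b_y; apply/missingP=> g zg.
    by have /missingP/(_ g zg) := bz; apply: contra => /eqP/(keep' _ _ nbc)->.
  - have [w [g [gzw Eg nwx low]]] := free_heavy_low psiP fxz bB nbz.
    by case: (no_low_edge_missing nbc Fphi b_y gzw (keep _ _ nbc Eg) nwx low).
  - have [w [g [gyw Eg nwx low]]] := free_heavy_low phiP exy bA nby.
    by case: (no_low_edge_missing nbc Fpsi bz gyw (keep' _ _ nbc Eg) nwx low).
  have [w1 [g1 [g1P Eg1 nw1 low1]]] := free_heavy_low phiP exy bA nby.
  have [w2 [g2 [g2P Eg2 nw2 low2]]] := free_heavy_low psiP fxz bB nbz.
  apply: (@no_low_pair x y z e f c b phi g1 w1 g2 w2); split=> //.
  exact: keep.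
have UC : A :|: B \subset ~: missing phi x by rewrite subUset AC.
have := subset_leq_card UC; have := subset_leq_card AB; have := cardsC (missing phi x).
have := cardsU A B; rewrite cards1 card_ord.
have := card_missing x phiP; rewrite (ends_l exy).
by have := subset_leq_card (subsetIl A B); count_lia.
Qed.

End Uncolourable.

(** * Critical graphs *)

Lemma mult_sigma'_le_degree (G : mgraph) (x y : G) :
  mult x y + sigma' x y <= degree y.
Proof.
rewrite -card_heavy; apply/subset_leq_card/subsetP=> h /heavy_end.
by rewrite inE.
Qed.

Lemma mult_le_max (G : mgraph) (x y : G) : x != y -> mult x y <= max_mult G.
Proof. by move=> nxy; apply: (leq_bigmax_cond (x, y)). Qed.

Lemma critical_not_colourable D G : critical D G -> ~~ edge_colourable G D.
Proof.
case=> _ chi _; apply/negP=> colD; move: chi; rewrite /chromatic_index.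
by case: ex_minnP => k _ /(_ _ colD) + Ek; rewrite Ek ltnn.
Qed.

Lemma critical_colouring_but D G (e : edge G) : critical D G ->
  exists phi : edge G -> option 'I_D, colouring_but e phi.
Proof.
move=> [_ chi crit].
have ends_setT f : f \in [set~ e] -> ends f \subset [set: G] by rewrite subsetT.
pose H := Subgraph ends_setT.
have properH : proper_subgraph H.
  apply/orP; right; apply/eqP=> /setP/(_ e).
  by rewrite !inE eqxx.
have := crit H properH; rewrite chi /chromatic_index.
case: (ex_minnP (edge_colourable_ex (graph_of_subgraph H))) => k /existsP[col].
move=> /forallP colP _ lekD; rewrite ltnS in lekD.
pose phi (f : edge G) : option 'I_D :=
  omap (fun f' : {f | f \in sub_edge H} => widen_ord lekD (col f')) (insub f).
exists phi; split=> [f g v vf vg | f]; last first.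
  rewrite /phi; case: insubP => [u | ] /=; rewrite in_setC1.
    by move=> /negPf->.
  by rewrite negbK => ->.
rewrite /phi; case: insubP => [f' _ Df|] //= _.
case: insubP => [g' _ Dg|] //= [Efg].
apply/eqP; rewrite -Df -Dg; apply/negPn/negP=> nfg.
have /forallP/(_ g')/implyP col_fg := colP f'.
suff: col f' != col g' by rewrite (val_inj Efg) eqxx.
apply: col_fg; apply/andP; split; first by apply: contraNneq nfg => ->.
have vT : v \in [set: G] by rewrite inE.
apply/set0Pn; exists (Sub v vT : {v | v \in sub_vert H}).
by rewrite !inE /= Df Dg vf.
Qed.

Local Open Scope ring_scope.

Theorem lemma2p6 (G : mgraph) (D : nat) (x y : G)
    (hG : critical D G) (hxy : edges x y != set0) :
  exists Z : {set G},
    [/\ Z \subset kierstead y x,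
        #|edges_to x Z|%:Z >= D%:Z - (sigma' x y)%:Z - (mult x y)%:Z + 1,
        D%:Z - (sigma' x y)%:Z - (mult x y)%:Z + 1 >= D%:Z - (degree y)%:Z + 1
      & forall z : G, z \in Z ->
          (sigma' x y)%:Z + (sigma' x z)%:Z
            >= 2 * D%:Z - (degree x)%:Z + 2 - (mult x y)%:Z - (mult x z)%:Z
          /\ 2 * D%:Z - (degree x)%:Z + 2 - (mult x y)%:Z - (mult x z)%:Z
            >= 2 * D%:Z - (degree x)%:Z - 2 * (max_mult G)%:Z + 2].
Proof.
have [maxG _ _] := hG; have class2 := critical_not_colourable hG.
have [e exy] := set0Pn _ hxy; have [phi phiP] := critical_colouring_but e hG.
(* With the sizes of the sets of free colours substituted, the inequality reads
   that they have at most [degree x] elements together. *)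
pose Z := [set z in kierstead y x |
  2 * D + 2 <= degree x + (mult x y + sigma' x y) + (mult x z + sigma' x z)]%N.
exists Z; split.
- by apply/subsetP=> z; rewrite inE => /andP[].
- have := card_free_heavy phiP exy.
  suff : (#|free phi (heavy x y)| <= #|edges_to x Z|)%N by count_lia.
  rewrite -(card_imset _ (@Some_inj _)).
  apply: leq_trans (leq_imset_card phi _).
  apply/subset_leq_card/subsetP=> _ /imsetP[c cH ->].
  have ncx := free_heavy_not_missing maxG class2 phiP exy cH.
  have [z [f [fxz Ef]]] := present ncx.
  apply/imsetP; exists f => //; rewrite inE; apply/exists_inP; exists z => //.
  have [psi Fpsi] := fan_of_free_heavy maxG class2 phiP exy fxz Ef cH.
  have degs := fan_degrees maxG class2 Fpsi.
  rewrite inE; apply/andP; split.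
    rewrite inE in_setD1 (fan_neq Fpsi) inE maxG; apply/andP; split.
      by apply/set0Pn; exists f.
    count_lia.
  have [psiP _ _ _ _] := Fpsi; have [psiP' _ _ _ _] := fan_shift Fpsi.
  have := fan_free_heavy maxG class2 Fpsi.
  have := card_free_heavy psiP exy; have := card_free_heavy psiP' fxz.
  count_lia.
- by have := mult_sigma'_le_degree x y; count_lia.
move=> z; rewrite inE => /andP[]; rewrite inE in_setD1 inE.
move=> /andP[/andP[_ /set0Pn[f fxz]] _] ineq.
have := mult_le_max (edges_neq exy); have := mult_le_max (edges_neq fxz).
count_lia.
Qed.
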